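(* Let $f\colon X\to Y$ be a map of digital images, where $X\subseteq\mathbb{Z}^2$ and $Y\subseteq\mathbb{Z}^n$. For any $k\ge1$ there is a map $\widehat{f}\colon S(X,2k+1)\to S(Y,2k+1)$ such that $$\rho_{2k+1}\circ\widehat{f}=f\circ\rho_{2k+1}\colon S(X,2k+1)\to Y.$$
   Context: A digital image (of dimension $n$) is a finite subset $X\subseteq\mathbb{Z}^n$ with the adjacency relation: $x\sim_X y$ iff $|x_i-y_i|\le 1$ for every $i=1,\dots,n$ (so each point is adjacent to itself). A function $f\colon X\to Y$ of digital images is continuous if $x\sim_X x'$ implies $f(x)\sim_Y f(x')$; a map means a continuous function. For $X\subseteq\mathbb{Z}^n$ a digital image and an integer $m\ge2$, the $m$-subdivision of $X$ is $S(X,m)=\{(y_1,\dots,y_n)\in\mathbb{Z}^n \mid (\lfloor y_1/m\rfloor,\dots,\lfloor y_n/m\rfloor)\in X\}$, and the standard projection is the (continuous) map $\rho_m\colon S(X,m)\to X$, $\rho_m(y_1,\dots,y_n)=(\lfloor y_1/m\rfloor,\dots,\lfloor y_n/m\rfloor)$. *)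

(* Defs.v *)
From mathcomp Require Import all_boot all_order all_algebra.
From mathcomp Require Import boolp classical_sets functions cardinality.
From mathcomp Require Import zify.

Set Implicit Arguments.
Unset Strict Implicit.
Unset Printing Implicit Defensive.

Import Order.TTheory GRing.Theory Num.Theory.
Local Open Scope classical_set_scope.
Local Open Scope ring_scope.

Definition digital_image n (X : set 'rV[int]_n) : Prop := finite_set X.

Definition adjacent n (x y : 'rV[int]_n) : Prop :=
  forall i : 'I_n, `|x 0 i - y 0 i| <= 1.

(* [X] and [Y] are coerced to the subtypes of their points. *)
Definition digital_continuous n p (X : set 'rV[int]_n) (Y : set 'rV[int]_p)
    (f : X -> Y) : Prop :=
  forall x x' : X, adjacent (val x) (val x') -> adjacent (val (f x)) (val (f x')).

(* For [0 < m], [divz] by [m] is the floor of the rational quotient. *)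
Definition floor_div n (m : nat) (y : 'rV[int]_n) : 'rV[int]_n :=
  \row_(i < n) divz (y 0 i) m.

Definition subdivision n (X : set 'rV[int]_n) (m : nat) : set 'rV[int]_n :=
  [set y | X (floor_div m y)].

Lemma mem_floor_div n (X : set 'rV[int]_n) m (y : subdivision X m) :
  floor_div m (val y) \in X.
Proof. exact/mem_set/(set_mem (valP y)). Qed.

Definition rho n (X : set 'rV[int]_n) m (y : subdivision X m) : X :=
  exist _ (floor_div m (val y)) (mem_floor_div y).
Arguments rho {n} X m y.

Lemma subdivision_digital_image n (X : set 'rV[int]_n) m :
  (0 < m)%N -> digital_image X -> digital_image (subdivision X m).
Proof.
move=> m_gt0 finX.
pose g (xr : 'rV[int]_n * {ffun 'I_n -> 'I_m}) : 'rV[int]_n :=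
  \row_i (xr.1 0 i * m%:Z + (xr.2 i : nat)%:Z).
apply: (@sub_finite_set _ _ (g @` (X `*` setT))); last first.
  by apply: finite_image; apply: finite_setX => //; exact: finite_finset.
move=> y Xy.
have lt_m i : (`|modz (y 0%R i) m| < m)%N by lia.
exists (floor_div m y, [ffun i => Ordinal (lt_m i)]) => //.
by apply/rowP => i; rewrite !mxE ffunE /=; lia.
Qed.

Lemma rho_continuous n (X : set 'rV[int]_n) m :
  (0 < m)%N -> digital_continuous (rho X m).
Proof.
move=> m_gt0 y y' adj i; have := adj i; rewrite /= !mxE; nia.
Qed.

(* Main.v *)
Require Import Defs.
From mathcomp Require Import all_boot all_order all_algebra.
From mathcomp Require Import boolp classical_sets functions cardinality reals.
From mathcomp Require Import zify.

(** The lift exists because both adjacency and floor division are coordinatewise.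
Applying floor division by [m] to a point is applying it to each coordinate, and
a point with integer coordinates [h i y] lies in the subdivision of [Y] as soon
as its projection is [f (rho y)].  Hence it suffices to lift one integer-valued
function [g] on [X] that varies by at most [1] between adjacent points
([exists_integer_lift]).

For such a [g], the lift at [y] is constrained to the interval from
[m * g (rho y)] to [m * g (rho y) + (m - 1)].  The lift used is a truncated
McShane extension of the lower end of these intervals: the maximum of
[m * g (rho y') - d] over the points [y'] of the subdivision within sup-distance
[d <= m] of [y].  Points within distance [m] project to adjacent points
([floor_div_adjacent]), so a competitor at distance [d] exceeds
[m * g (rho y)] by at most [m - d], and by [0] when [d = 0] since then [y' = y];
this keeps the maximum within the interval.  Moving [y] by one step
lowers the maximum by at most one: a competitor at distance [d < m] is at
distance at most [d + 1] of the new point, and a competitor at distance [m] is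
worth no more than [m * g (rho y)], which the old point itself achieves. *)

Set Implicit Arguments.
Unset Strict Implicit.
Unset Printing Implicit Defensive.

Import Order.TTheory GRing.Theory Num.Theory.
Local Open Scope classical_set_scope.
Local Open Scope ring_scope.

Definition within n (d : nat) (x y : 'rV[int]_n) : Prop :=
  forall i : 'I_n, `|x 0 i - y 0 i| <= d%:Z.

Lemma withinxx n d (x : 'rV[int]_n) : within d x x.
Proof. by move=> i; rewrite subrr normr0. Qed.

Lemma within_trans n d e (x y z : 'rV[int]_n) :
  within d x y -> within e y z -> within (d + e) x z.
Proof. by move=> xy yz i; have := xy i; have := yz i; lia. Qed.

Lemma adjacent_sym n (x y : 'rV[int]_n) : adjacent x y -> adjacent y x.
Proof. by move=> xy i; rewrite distrC. Qed.

Lemma floor_div_adjacent n m (x y : 'rV[int]_n) :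
  (0 < m)%N -> within m x y -> adjacent (floor_div m x) (floor_div m y).
Proof. by move=> m_gt0 xy i; have := xy i; rewrite !mxE; nia. Qed.

Lemma exists_max_int (P : int -> Prop) (a b : int) :
  P a -> (forall z, P z -> z <= b) ->
  exists2 c, P c & forall z, P z -> z <= c.
Proof.
move=> Pa Pb; pose B : set int := [set z | P (- z)].
have B0 : B !=set0 by exists (- a); rewrite /B /= opprK.
have [|c [Pc minc]] := @int_lbound_has_minimum B (- b) B0.
  by move=> z /Pb; rewrite lerNl.
by exists (- c) => // z Pz; rewrite lerNr; apply: minc; rewrite /B /= opprK.
Qed.

(** Solved by the truncated McShane extension.  The predicate [worth y] in the
proof describes the integers below some competing value, so that its maximum is
the wanted one while [d] need only bound the distance to [y']. *)
Lemma exists_integer_lift p (X : set 'rV[int]_p) m (g : X -> int) :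
    (0 < m)%N ->
    (forall x x' : X, adjacent (val x) (val x') -> `|g x - g x'| <= 1) ->
  exists h : subdivision X m -> int,
    (forall y, divz (h y) m = g (rho X m y)) /\
    (forall y y' : subdivision X m,
       adjacent (val y) (val y') -> `|h y - h y'| <= 1).
Proof.
move=> m_gt0 g_lip.
pose worth (y : subdivision X m) (z : int) :=
  exists d (y' : subdivision X m),
    [/\ (d <= m)%N, within d (val y) (val y')
      & z <= m%:Z * g (rho X m y') - d%:Z].
have worth_base y : worth y (m%:Z * g (rho X m y)).
  by exists 0%N, y; split=> //; [exact: withinxx | lia].
have worth_le y z : worth y z -> z <= m%:Z * g (rho X m y) + m%:Z - 1.
  move=> [[|d] [y' [le_dm yy' le_z]]].
    (* at distance 0 the competitor is [y] itself *)
    suff yE : y = y' by rewrite yE; lia.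
    by apply/val_inj/rowP => i; have := yy' i; lia.
  have : adjacent (val (rho X m y)) (val (rho X m y')).
    by apply: floor_div_adjacent => // i; have := yy' i; lia.
  by move/g_lip; nia.
have worth_step y1 y2 z :
    adjacent (val y1) (val y2) -> worth y1 z -> worth y2 (z - 1).
  move=> /adjacent_sym y21 [d [y' [le_dm y1y' le_z]]].
  have [lt_dm | ge_dm] := ltnP d m.
    exists d.+1, y'; split=> //; last by lia.
    exact: (within_trans (d := 1) y21 y1y').
  (* at distance [m] the competitor is replaced by [y1] *)
  exists 1%N, y1; split=> //.
  have : adjacent (val (rho X m y1)) (val (rho X m y')).
    by apply: floor_div_adjacent => // i; have := y1y' i; lia.
  by move/g_lip; nia.
have /choice[h hP] y : exists c, worth y c /\ forall z, worth y z -> z <= c.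
  by have [c ? ?] := exists_max_int (worth_base y) (@worth_le y); exists c.
exists h; split=> [y | y1 y2 y12].
  have [/worth_le le_h /(_ _ (worth_base y)) ge_h] := hP y.
  by nia.
have [w1 max1] := hP y1; have [w2 max2] := hP y2.
have := max2 _ (worth_step _ _ _ y12 w1).
have := max1 _ (worth_step _ _ _ (adjacent_sym y12) w2).
by lia.
Qed.

Lemma exists_subdivision_lift p n (X : set 'rV[int]_p) (Y : set 'rV[int]_n)
    (f : X -> Y) m :
    (0 < m)%N -> digital_continuous f ->
  exists2 fhat : subdivision X m -> subdivision Y m,
    digital_continuous fhat & rho Y m \o fhat = f \o rho X m.
Proof.
move=> m_gt0 f_cont.
have /choice[h hP] (i : 'I_n) := exists_integer_lift (g := fun x => val (f x) 0 i)
  m_gt0 (fun x x' xx' => f_cont x x' xx' i).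
pose hrow y : 'rV[int]_n := \row_i h i y.
have hrowE y : floor_div m (hrow y) = val (f (rho X m y)).
  by apply/rowP => i; rewrite !mxE (hP i).1.
have hrowS y : hrow y \in subdivision Y m.
  by apply/mem_set; rewrite /subdivision /= hrowE; exact: set_mem (valP _).
exists (fun y => exist _ (hrow y) (hrowS y)).
  by move=> y y' yy' i; rewrite /= !mxE; exact: (hP i).2.
by apply/funext => y; apply/val_inj; exact: hrowE.
Qed.

Theorem theorem5p5 (n : nat) (X : set 'rV[int]_2) (Y : set 'rV[int]_n)
    (hX : digital_image X) (hY : digital_image Y)
    (f : X -> Y) (hf : digital_continuous f) (k : nat) (hk : (1 <= k)%N) :
  exists2 fhat : subdivision X (2 * k + 1) -> subdivision Y (2 * k + 1),
    digital_continuous fhat &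
    rho Y (2 * k + 1) \o fhat = f \o rho X (2 * k + 1).
Proof. by apply: exists_subdivision_lift hf; rewrite addn1. Qed.
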